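(* For every integer $r\ge 1$ let $\mathscr{P}_{B_r}(q)$ be the $q$-analog of Kostant's partition function evaluated at the highest root of type $B_r$ (defined in the context). Then, as formal power series in $x$ with coefficients in $\mathbb{Z}[q]$, \[ \sum_{r\geq 1}\mathscr{P}_{B_r}(q)x^r=\frac{qx+(-q-q^2)x^2+q^2x^3}{1-(2+2q+q^2)x+(1+2q+q^2+q^3)x^2}. \]
   Context: Type $B_r$ (the Lie algebra $\mathfrak{so}_{2r+1}(\mathbb{C})$), $r\ge1$: with simple roots $\alpha_1,\dots,\alpha_r$, the positive roots are the ''nonhooked'' roots $\alpha_i+\alpha_{i+1}+\cdots+\alpha_j$ for $1\le i\le j\le r$ and the ''hooked'' roots $\alpha_i+\cdots+\alpha_{j-1}+2\alpha_j+2\alpha_{j+1}+\cdots+2\alpha_r$ for $1\le i<j\le r$. The highest root is $\tilde\alpha=\alpha_1+2\alpha_2+\cdots+2\alpha_r$ (for $r=1$ it is $\alpha_1$). A partition of $\tilde\alpha$ with $k$ parts is a multiset $\{\beta_1,\dots,\beta_k\}$ of positive roots (repetitions allowed) with $\beta_1+\cdots+\beta_k=\tilde\alpha$. The $q$-analog of Kostant's partition function at $\tilde\alpha$ is $\mathscr{P}_{B_r}(q)=\sum_{k\ge1}a_kq^k$, where $a_k$ is the number of partitions of $\tilde\alpha$ with exactly $k$ parts. *)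

(* Defs.v *)
From HB Require Import structures.
From mathcomp Require Import all_boot all_order all_algebra.
From mathcomp Require Import zify ring lra.

Set Implicit Arguments.
Unset Strict Implicit.
Unset Printing Implicit Defensive.

Import Order.TTheory GRing.Theory Num.Theory.
Local Open Scope ring_scope.

(* The root lattice of type B_r is Z^r, in coordinates with respect to the
   simple roots; the indices 1, ..., r are shifted to 0, ..., r - 1. *)
Definition simple_root (r : nat) (i : 'I_r) : 'rV[int]_r := delta_mx 0 i.

Definition nonhooked (r : nat) (i j : 'I_r) : 'rV[int]_r :=
  \sum_(k < r | (i <= k <= j)%N) simple_root k.

Definition hooked (r : nat) (i j : 'I_r) : 'rV[int]_r :=
  \sum_(k < r | (i <= k < j)%N) simple_root k +
  \sum_(k < r | (j <= k)%N) simple_root k *+ 2.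

Definition posroots (r : nat) : seq 'rV[int]_r :=
  [seq nonhooked p.1 p.2 | p : 'I_r * 'I_r
     <- enum {: 'I_r * 'I_r} & (p.1 <= p.2)%N] ++
  [seq hooked p.1 p.2 | p : 'I_r * 'I_r
     <- enum {: 'I_r * 'I_r} & (p.1 < p.2)%N].

Definition highest_root (r : nat) : 'rV[int]_r :=
  \sum_(k < r) simple_root k *+ (if k == 0%N :> nat then 1 else 2).

(* A multiset with k parts is given by its multiplicity function, whose values
   are at most k, so that the codomain 'I_k.+1 is no restriction. *)
Definition root_partitions (r k : nat) :
    {set {ffun seq_sub (posroots r) -> 'I_k.+1}} :=
  [set m : {ffun seq_sub (posroots r) -> 'I_k.+1} |
     (\sum_b m b == k)%N & \sum_b ssval b *+ m b == highest_root r].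

(* The sum stops at k = 2r - 1, the height of the highest root: see
   root_partitions_eq0 and coef_kostantB. *)
Definition kostantB (r : nat) : {poly int} :=
  \sum_(1 <= k < r.*2) #|root_partitions r k|%:R *: 'X^k.

Definition height (r : nat) (v : 'rV[int]_r) : int := \sum_i v 0 i.

Lemma height_sum r (I : Type) (s : seq I) (P : pred I) (F : I -> 'rV[int]_r) :
  height (\sum_(i <- s | P i) F i) = \sum_(i <- s | P i) height (F i).
Proof.
rewrite /height exchange_big; apply: eq_bigr => j _.
by rewrite summxE.
Qed.

Lemma heightMn r (v : 'rV[int]_r) n : height (v *+ n) = height v *+ n.
Proof.
rewrite /height -sumrMnl; apply: eq_bigr => i _.
by rewrite mulmxnE.
Qed.

Lemma heightD r (v w : 'rV[int]_r) : height (v + w) = height v + height w.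
Proof. by rewrite /height -big_split; apply: eq_bigr => i _; rewrite mxE. Qed.

Lemma height_simple r (i : 'I_r) : height (simple_root i) = 1.
Proof.
rewrite /height (bigD1 i) //= big1 ?addr0 ?mxE ?eqxx // => j /negPf ji.
by rewrite mxE ji andbF.
Qed.

Lemma height_posroot r (v : 'rV[int]_r) : v \in posroots r -> 1 <= height v.
Proof.
rewrite mem_cat => /orP[] /mapP[[i j]]; rewrite mem_filter /= => /andP[ij _] ->.
- rewrite /nonhooked height_sum (bigD1 i) ?leqnn //= height_simple lerDl.
  by apply: sumr_ge0 => k _; rewrite height_simple.
- rewrite /hooked heightD !height_sum (bigD1 i) ?leqnn //= height_simple.
  rewrite -addrA lerDl; apply: addr_ge0; apply: sumr_ge0 => k _.
    by rewrite height_simple.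
  by rewrite heightMn height_simple.
Qed.

Lemma height_highest r : (0 < r)%N -> height (highest_root r) = r.*2.-1%:Z.
Proof.
case: r => // r _; rewrite /highest_root height_sum big_ord_recl /=.
rewrite mulr1n height_simple.
rewrite (eq_bigr (fun=> 2)); last by move=> i _; rewrite heightMn height_simple.
by rewrite sumr_const card_ord; lia.
Qed.

Lemma root_partitions_eq0 r k :
  (0 < r)%N -> (k == 0%N) || (r.*2 <= k)%N -> #|root_partitions r k| = 0%N.
Proof.
move=> r0 hk; apply: eq_card0 => m; rewrite inE; apply/negP => /andP[/eqP sk].
move=> /eqP/(congr1 (@height r)); rewrite height_highest // height_sum => sh.
have le_k : k%:Z <= r.*2.-1%:Z.
  rewrite -sh -{1}sk -natz natr_sum; apply: ler_sum => b _.
  by rewrite heightMn lerMn2r height_posroot ?orbT // ssvalP.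
case/orP: hk => [/eqP k0|]; last by lia.
suff : r.*2.-1%:Z = 0 by lia.
rewrite -sh big1 // => b _; rewrite heightMn.
by case: (m b) => -[|n] hn //=; exfalso; move: hn; rewrite k0 ltnS.
Qed.

Lemma coef_kostantB r k :
  (0 < r)%N -> (kostantB r)`_k = #|root_partitions r k|%:R.
Proof.
move=> r0; rewrite /kostantB coef_sum.
under eq_bigr do rewrite coefZ coefXn.
case: (boolP ((k == 0%N) || (r.*2 <= k)%N)) => hk.
  rewrite root_partitions_eq0 // big_nat big1 // => i hi.
  have /negPf-> : k != i by lia.
  by rewrite mulr0.
have hin : k \in index_iota 1 r.*2 by rewrite mem_index_iota; lia.
rewrite (bigD1_seq k hin (iota_uniq _ _)) /= eqxx mulr1 big1 ?addr0 // => i.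
by rewrite eq_sym => /negPf->; rewrite mulr0.
Qed.

(* The formal power series \sum_n (a n) x^n is its coefficient sequence a. *)
Definition fps (R : Type) := nat -> R.

Definition fps_of_poly (R : nzRingType) (p : {poly R}) : fps R :=
  fun n => p`_n.

Definition fps_mul (R : nzRingType) (a b : fps R) : fps R :=
  fun n => \sum_(i < n.+1) a i * b (n - i)%N.

(* The first n coefficients of the inverse of a, by the usual recurrence
   b_n = a_0^-1 (delta_{n,0} - \sum_(i < n) a_(n-i) b_i). *)
Fixpoint fps_inv_prefix (R : comUnitRingType) (a : fps R) (n : nat) : seq R :=
  if n is m.+1 then
    let b := fps_inv_prefix a m in
    rcons b ((a 0%N)^-1 * ((m == 0%N)%:R - \sum_(i < m) a (m - i)%N * b`_i))
  else [::].

Definition fps_inv (R : comUnitRingType) (a : fps R) : fps R :=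
  fun n => (fps_inv_prefix a n.+1)`_n.

Definition fps_div (R : comUnitRingType) (a b : fps R) : fps R :=
  fps_mul a (fps_inv b).

Lemma size_fps_inv_prefix (R : comUnitRingType) (a : fps R) n :
  size (fps_inv_prefix a n) = n.
Proof. by elim: n => //= n IH; rewrite size_rcons IH. Qed.

Lemma nth_fps_inv_prefix (R : comUnitRingType) (a : fps R) n i :
  (i < n)%N -> (fps_inv_prefix a n)`_i = fps_inv a i.
Proof.
elim: n => // n IH; rewrite ltnS leq_eqVlt => /orP[/eqP-> //|lt_in].
by rewrite /= nth_rcons size_fps_inv_prefix lt_in IH.
Qed.

Lemma fps_invE (R : comUnitRingType) (a : fps R) n :
  fps_inv a n =
  (a 0%N)^-1 * ((n == 0%N)%:R - \sum_(i < n) a (n - i)%N * fps_inv a i).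
Proof.
rewrite {1}/fps_inv /= nth_rcons size_fps_inv_prefix ltnn eqxx.
by under eq_bigr => i _ do rewrite nth_fps_inv_prefix //.
Qed.

Lemma fps_mulV (R : comUnitRingType) (a : fps R) :
  a 0%N \is a GRing.unit ->
  fps_mul a (fps_inv a) =1 fps_of_poly (1 : {poly R}).
Proof.
move=> ua n; rewrite /fps_mul /fps_of_poly coef1.
rewrite (reindex_inj rev_ord_inj) /= big_ord_recr /= subSS subnn subn0.
rewrite [fps_inv a n]fps_invE mulVKr //.
rewrite [X in X + _](_ : _ = \sum_(i < n) a (n - i)%N * fps_inv a i).
  by rewrite addrC subrK.
by apply: eq_bigr => i _; rewrite subSS subKn // ltnW.
Qed.

Definition kostantB_gf : fps {poly int} :=
  fun r => if (1 <= r)%N then kostantB r else 0.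

(* Main.v *)
(** Every positive root involving the first simple root has coefficient 1 there,
    and the other positive roots form a root system of type B_(r-1).  So a
    partition of a vector of first coordinate c consists of c roots starting at
    the first coordinate together with a partition of what they leave over.

    Reading a partition of the highest root (1, 2, ..., 2) from left to right,
    each coordinate after the first is covered either by the doubled part of a
    single hooked root, and then everything after it is forced, or by two
    "strands" of multiplicity one.  The strands are distinguishable (d) or equal
    (s) according to whether they start at different coordinates or at the same
    one.  Moving by one coordinate gives
      d' = (1 + 2 q) d + q^2 s + 2,    s' = q d + (1 + q^2) s + 1,
    and P_(n+2) = q (1 + q d_n + q^2 s_n).  The transfer matrix has trace
    2 + 2 q + q^2 and determinant 1 + 2 q + q^2 + q^3, and (-1/q, 0) is a fixed
    point of the affine map, which is exactly the constant killed in P; hence P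
    satisfies the recurrence given by the denominator. *)

Require Import Defs.
From mathcomp Require Import all_boot all_order all_algebra.
From mathcomp Require Import zify ring.

Set Implicit Arguments.
Unset Strict Implicit.
Unset Printing Implicit Defensive.

Import Order.TTheory GRing.Theory Num.Theory.
Local Open Scope ring_scope.

(** * Counting multisets of given size and sum *)

Section Multisets.
Variable V : zmodType.

(** Counts multisets of size [k] and sum [v]: either [b] is discarded for good, or one copy is
    removed and [b] stays available. The inner recursion on [k] bounds the number of copies. *)
Fixpoint nb_msets (L : seq V) : nat -> V -> int :=
  if L is b :: L' then
    fix go k v :=
      if k is k'.+1 then nb_msets L' k v + go k' (v - b) else nb_msets L' 0%N v
  else fun k v => ((k == 0%N) && (v == 0))%:R.

Lemma nb_msets_cons b L k v :
  nb_msets (b :: L) k v =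
  nb_msets L k v + (if k is k'.+1 then nb_msets (b :: L) k' (v - b) else 0).
Proof. by case: k => //; rewrite addr0. Qed.

Section Card.
Variables (I : finType) (F : I -> V) (B : nat).

(** The bound [B] is separate from [k], so that the ambient type stays fixed during the induction on
    [k]. *)
Definition mset_fun (s : seq I) (k : nat) (v : V) : {set {ffun I -> 'I_B.+1}} :=
  [set m : {ffun I -> 'I_B.+1} |
    [&& [forall i, (i \notin s) ==> (m i == 0%N :> nat)],
        (\sum_i m i == k)%N & \sum_i F i *+ m i == v]].

Lemma mset_funP s k v (m : {ffun I -> 'I_B.+1}) :
  reflect [/\ forall i, i \notin s -> m i = 0%N :> nat,
              (\sum_i m i)%N = k & \sum_i F i *+ m i = v]
          (m \in mset_fun s k v).
Proof.
rewrite inE; apply: (iffP and3P) => [[/forallP h /eqP hk /eqP hv]|[h hk hv]].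
  by split=> // i hi; apply/eqP; move: (h i); rewrite hi.
split; try exact/eqP.
by apply/forallP => i; apply/implyP => /h /eqP.
Qed.

Lemma card_mset_fun_nil k v :
  #|mset_fun [::] k v|%:R = nb_msets [::] k v.
Proof.
rewrite /=; congr (_%:R).
have zero_in : ([ffun=> ord0] \in mset_fun [::] k v) = (k == 0%N) && (v == 0).
  apply/mset_funP/andP => [[_ <- <-]|[/eqP-> /eqP->]].
    by split; apply/eqP; rewrite big1 // => i _; rewrite ffunE.
  by split=> [i _||]; rewrite ?ffunE // big1 // => i _; rewrite ffunE.
have only0 m : m \in mset_fun [::] k v -> m = [ffun=> ord0].
  by case/mset_funP => h _ _; apply/ffunP => i; apply: val_inj;
    rewrite ffunE /= h.
rewrite -zero_in; case: (boolP (_ \in _)) => h0.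
  rewrite -[RHS](cards1 ([ffun=> ord0] : {ffun I -> 'I_B.+1})).
  apply: eq_card => m; rewrite [in RHS]inE.
  by apply/idP/eqP => [/only0|->].
by apply: eq_card0 => m; apply/negP => hm; move: h0; rewrite -(only0 _ hm) hm.
Qed.

Lemma mset_fun_consE b s k v : b \notin s ->
  [set m in mset_fun (b :: s) k v | m b == 0%N :> nat] = mset_fun s k v.
Proof.
move=> bs; apply/setP => m; rewrite [in LHS]inE.
apply/andP/mset_funP => [[/mset_funP[h hk hv] /eqP hb]|[h hk hv]].
  split=> // i his; have [->//|nib] := eqVneq i b.
  by apply: h; rewrite inE negb_or nib.
split; last by rewrite h.
by apply/mset_funP; split=> // i; rewrite inE negb_or => /andP[_ /h].
Qed.

Definition mset_incr b (m : {ffun I -> 'I_B.+1}) : {ffun I -> 'I_B.+1} :=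
  [ffun i => if i == b then inord (m i).+1 else m i].

Lemma mset_incr_sum b (m : {ffun I -> 'I_B.+1}) (W : zmodType) (G : I -> W) :
  (m b < B)%N ->
  \sum_i G i *+ mset_incr b m i = G b + \sum_i G i *+ m i.
Proof.
move=> hb; rewrite (bigD1 b) //= [in RHS](bigD1 b) //= addrA -mulrS.
rewrite ffunE eqxx inordK ?ltnS //; congr (_ + _).
by apply: eq_bigr => i /negPf nib; rewrite ffunE nib.
Qed.

Lemma mset_incr_size b (m : {ffun I -> 'I_B.+1}) : (m b < B)%N ->
  (\sum_i mset_incr b m i)%N = (\sum_i m i).+1.
Proof.
move=> hb; rewrite (bigD1 b) //= [in RHS](bigD1 b) //= -addSn.
rewrite ffunE eqxx inordK ?ltnS //; congr (_ + _)%N.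
by apply: eq_bigr => i /negPf nib; rewrite ffunE nib.
Qed.

Lemma mset_fun_lt b s k v (m : {ffun I -> 'I_B.+1}) :
  (k < B)%N -> m \in mset_fun s k v -> (m b < B)%N.
Proof.
move=> hk /mset_funP[_ hs _]; apply: leq_ltn_trans hk.
by rewrite -hs (bigD1 b) //= leq_addr.
Qed.

Lemma mset_fun_incrE b s k v : (k < B)%N ->
  [set m in mset_fun (b :: s) k.+1 v | m b != 0%N :> nat] =
  mset_incr b @: mset_fun (b :: s) k (v - F b).
Proof.
move=> hk; apply/setP => m; rewrite inE; apply/andP/imsetP.
  case=> /mset_funP[h hs hv] hb.
  pose d : {ffun I -> 'I_B.+1} :=
    [ffun i => if i == b then inord (m i).-1 else m i].
  have pb : (inord (m b).-1 : 'I_B.+1) = (m b).-1 :> nat.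
    by rewrite inordK // (leq_ltn_trans (leq_pred _)).
  have db : d b = (m b).-1 :> nat by rewrite ffunE eqxx pb.
  have dE : m = mset_incr b d.
    apply/ffunP => i; rewrite !ffunE; case: eqP => [->|//]; apply: val_inj.
    by rewrite /= inordK pb prednK ?lt0n.
  have dlt : (d b < B)%N.
    by rewrite db -ltnS prednK ?lt0n // ltn_ord.
  exists d => //; apply/mset_funP; split.
  - move=> i his; have := h i his; rewrite ffunE; case: eqP => // ib.
    by rewrite ib inE eqxx in his.
  - by move: hs; rewrite dE mset_incr_size // => -[].
  - by rewrite -hv dE mset_incr_sum // addrC addKr.
case=> d hd ->; have hlt := mset_fun_lt b hk hd.
case/mset_funP: hd => h hs hv; split.
  apply/mset_funP; split.
  - move=> i his; rewrite ffunE; case: eqP => ib; last exact: h.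
    by rewrite ib inE eqxx in his.
  - by rewrite mset_incr_size // hs.
  - by rewrite mset_incr_sum // hv addrC subrK.
by rewrite ffunE eqxx inordK.
Qed.

Lemma mset_incr_inj b s k v : (k < B)%N ->
  {in mset_fun s k v &, injective (mset_incr b)}.
Proof.
move=> hk m1 m2 /(mset_fun_lt b hk) h1 /(mset_fun_lt b hk) h2 /ffunP e.
apply/ffunP => i; have := e i; rewrite !ffunE; case: eqP => // ->.
move/(congr1 val); rewrite /= !inordK ?ltnS // => -[]; exact: val_inj.
Qed.

(** Functions with [m b = 0] are supported on [s]; the others come from one increment at [b] of
    functions of size one less. This is the recursion of [nb_msets]. *)
Lemma card_mset_fun s k v : uniq s -> (k <= B)%N ->
  #|mset_fun s k v|%:R = nb_msets (map F s) k v.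
Proof.
elim: s k v => [|b s IHs] k v; first by rewrite card_mset_fun_nil.
case/andP=> bs us; elim: k v => [|k IHk] v hk; rewrite map_cons nb_msets_cons.
  rewrite addr0 -IHs // -(mset_fun_consE _ _ bs); congr (_%:R).
  apply: eq_card => m; rewrite [in RHS]inE.
  case: (boolP (_ \in _)) => //= /mset_funP[_ hs _].
  by apply/esym; move/eqP: hs; rewrite sum_nat_eq0 => /forallP/(_ b).
rewrite -IHs // -map_cons -IHk; last exact: ltnW.
rewrite -natrD; congr (_%:R).
rewrite -(card_in_imset (@mset_incr_inj b _ _ _ hk)) -mset_fun_incrE //.
rewrite -(mset_fun_consE _ _ bs).
rewrite -[LHS](cardsID [set m : {ffun I -> 'I_B.+1} | m b == 0%N :> nat]).
by congr (_ + _)%N; apply: eq_card => m; rewrite !inE // andbC.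
Qed.

End Card.

(** Only the set of elements of [s] matters, so a list suited to recursion may replace the given
    enumeration. *)
Lemma card_msets_seq_sub (s L : seq V) k v : uniq L -> s =i L ->
  #|[set m : {ffun seq_sub s -> 'I_k.+1} |
     (\sum_b m b == k)%N & \sum_b ssval b *+ m b == v]|%:R = nb_msets L k v.
Proof.
move=> uL sL; pose s' : seq (seq_sub s) := pmap insub L.
have s'E : map (@ssval _ s) s' = L.
  rewrite /s' (pmap_filter (insubK (seq_sub s))).
  by apply/all_filterP/allP => x; rewrite -sL /= isSome_insub.
rewrite -[in RHS]s'E -(@card_mset_fun _ _ k) //; last first.
  by apply: (@map_uniq _ _ (@ssval _ s)); rewrite s'E.
congr (_%:R); apply: eq_card => m; rewrite !inE.
suff -> : [forall i, (i \notin s') ==> (m i == 0%N :> nat)] by [].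
apply/forallP => i; apply/implyP => /negP[].
by rewrite -(mem_map val_inj) s'E -sL; case: i.
Qed.

End Multisets.

(** * Splitting off the first coordinate of a row *)

Section ConsRow.
Variable n : nat.
Implicit Types (a b : int) (v w : 'rV[int]_n).

Definition cons_row a v : 'rV[int]_n.+1 :=
  \row_k (if unlift ord0 k is Some k' then v 0 k' else a).

Lemma cons_row_ord0 a v : cons_row a v 0 ord0 = a.
Proof. by rewrite mxE unlift_none. Qed.

Lemma cons_row_lift a v k : cons_row a v 0 (lift ord0 k) = v 0 k.
Proof. by rewrite mxE liftK. Qed.

Lemma cons_row_eta (u : 'rV[int]_n.+1) :
  u = cons_row (u 0 ord0) (\row_k u 0 (lift ord0 k)).
Proof.
apply/rowP => k; case: (unliftP ord0 k) => [k' ->|->].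
  by rewrite cons_row_lift mxE.
by rewrite cons_row_ord0.
Qed.

Lemma eq_cons_row a b v w :
  (cons_row a v == cons_row b w) = (a == b) && (v == w).
Proof.
apply/eqP/andP => [e|[/eqP-> /eqP->]//]; split; apply/eqP.
  by rewrite -(cons_row_ord0 a v) e cons_row_ord0.
by apply/rowP => k; rewrite -(cons_row_lift a v) e cons_row_lift.
Qed.

Lemma cons_row_inj a : injective (cons_row a).
Proof. by move=> v w /eqP; rewrite eq_cons_row => /andP[_ /eqP]. Qed.

Lemma cons_rowB a b v w :
  cons_row a v - cons_row b w = cons_row (a - b) (v - w).
Proof.
apply/rowP => k; case: (unliftP ord0 k) => [k' ->|->];
  rewrite !mxE ?liftK ?mxE //.
by rewrite unlift_none.
Qed.

Lemma cons_row_const a : cons_row a (const_mx a) = const_mx a.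
Proof.
by apply/rowP => k; case: (unliftP ord0 k) => [k' ->|->];
  rewrite !mxE ?liftK ?mxE ?unlift_none.
Qed.

Lemma cons_row0 : cons_row 0 0 = 0.
Proof. exact: cons_row_const. Qed.

End ConsRow.

(** * Counting by the first coordinate *)

(** Pairs are unordered and an entry may be paired with itself, as in multisets of size two. *)
Fixpoint sum_pairs (V : zmodType) (f : V -> int) (T : seq V) : int :=
  if T is x :: T' then \sum_(y <- T) f (x + y) + sum_pairs f T' else 0.

Section FirstCoordinate.
Variable n : nat.
Implicit Types (v : 'rV[int]_n) (R T : seq 'rV[int]_n).

(** Removing a listed vector never raises the first coordinate, so a negative one cannot return to
    zero. *)
Lemma nb_msets_lt0 (L : seq 'rV[int]_n.+1) k (u : 'rV[int]_n.+1) :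
  (forall b, b \in L -> 0 <= b 0 ord0) -> u 0 ord0 < 0 -> nb_msets L k u = 0.
Proof.
elim: L k u => [|b L IHL] k u hL hu.
  rewrite /=; case: (u =P 0) => [e|]; last by rewrite andbF.
  by rewrite e mxE ltxx in hu.
have hL' c : c \in L -> 0 <= c 0 ord0 by move=> cL; apply: hL;
  rewrite inE cL orbT.
elim: k u hu => [|k IHk] u hu; rewrite nb_msets_cons IHL ?add0r //.
by rewrite IHk // !mxE subr_lt0 (lt_le_trans hu) // hL ?mem_head.
Qed.

Lemma first_ge0 R T (b : 'rV[int]_n.+1) :
  b \in map (cons_row 1) T ++ map (cons_row 0) R -> 0 <= b 0 ord0.
Proof. by rewrite mem_cat => /orP[] /mapP[t _ ->]; rewrite cons_row_ord0. Qed.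

Lemma nb_msets_cons_row0 R k v :
  nb_msets (map (cons_row 0) R) k (cons_row 0 v) = nb_msets R k v.
Proof.
elim: R k v => [|b R IHR] k v; first by rewrite /= -cons_row0 eq_cons_row.
rewrite map_cons; elim: k v => [|k IHk] v;
  rewrite nb_msets_cons [in RHS]nb_msets_cons IHR //.
by rewrite cons_rowB subrr IHk.
Qed.

Lemma nb_msets_cons_row_ne0 R k a v :
  a != 0 -> nb_msets (map (cons_row 0) R) k (cons_row a v) = 0.
Proof.
move=> /negPf a0; elim: R k v => [|b R IHR] k v.
  by rewrite /= -cons_row0 eq_cons_row a0 andbF.
rewrite map_cons; elim: k v => [|k IHk] v; rewrite nb_msets_cons IHR //.
by rewrite cons_rowB subr0 IHk.
Qed.

Lemma nb_msets_first0 R T k v :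
  nb_msets (map (cons_row 1) T ++ map (cons_row 0) R) k (cons_row 0 v) =
  nb_msets R k v.
Proof.
elim: T k v => [|t T IHT] k v; first exact: nb_msets_cons_row0.
rewrite map_cons cat_cons nb_msets_cons IHT; case: k => [|k];
  first by rewrite addr0.
rewrite cons_rowB nb_msets_lt0 ?addr0 ?cons_row_ord0 //.
exact: (@first_ge0 R (t :: T)).
Qed.

(** Exactly one entry of [T] is used, once; its removal leaves first coordinate 0, where
    [nb_msets_first0] applies. *)
Lemma nb_msets_first1 R T k v :
  nb_msets (map (cons_row 1) T ++ map (cons_row 0) R) k (cons_row 1 v) =
  if k is k'.+1 then \sum_(t <- T) nb_msets R k' (v - t) else 0.
Proof.
elim: T k v => [|t T IHT] k v.
  by rewrite nb_msets_cons_row_ne0 //; case: k => // k; rewrite big_nil.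
rewrite map_cons cat_cons nb_msets_cons IHT; case: k => [|k];
  first by rewrite addr0.
by rewrite cons_rowB subrr (@nb_msets_first0 R (t :: T)) big_cons addrC.
Qed.

(** If [t] is the first entry of [T] used, the second comes from [t :: T], repetition being
    allowed. *)
Lemma nb_msets_first2 R T k v :
  nb_msets (map (cons_row 1) T ++ map (cons_row 0) R) k (cons_row 2 v) =
  if k is k'.+2 then sum_pairs (fun w => nb_msets R k' (v - w)) T else 0.
Proof.
elim: T k v => [|t T IHT] k v.
  by rewrite nb_msets_cons_row_ne0 //; case: k => [|[]].
rewrite map_cons cat_cons nb_msets_cons IHT; case: k => [|k];
  first by rewrite addr0.
rewrite cons_rowB (@nb_msets_first1 R (t :: T)).
case: k => [|k]; first by rewrite addr0.
rewrite addrC [in RHS]/sum_pairs -/sum_pairs; congr (_ + _).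
by apply: eq_bigr => y _; rewrite opprD addrA.
Qed.

End FirstCoordinate.

(** * Recursive list of the positive roots *)

(* What remains of a positive root of B_(n+1) that involves the first simple
   root, once its first coordinate 1 is dropped. *)
Fixpoint root_tails (n : nat) : seq 'rV[int]_n :=
  if n is m.+1 then 0 :: const_mx 2 :: map (cons_row 1) (root_tails m)
  else [:: 0].

Fixpoint roots_rec (n : nat) : seq 'rV[int]_n :=
  if n is m.+1 then map (cons_row 1) (root_tails m) ++
    map (cons_row 0) (roots_rec m)
  else [::].

Lemma cons_row_map_const (n : nat) (a b : int) (T : seq 'rV[int]_n) :
  a != b -> const_mx a \notin map (cons_row b) T.
Proof.
move=> ab; apply/mapP => -[t _ /rowP/(_ ord0)].
by rewrite cons_row_ord0 mxE => /eqP; rewrite (negPf ab).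
Qed.

Lemma root_tails_uniq n : uniq (root_tails n).
Proof.
elim: n => //= n IH; rewrite inE negb_or !cons_row_map_const //.
rewrite map_inj_uniq ?IH ?andbT; last exact: cons_row_inj.
by apply/eqP => /rowP/(_ ord0); rewrite !mxE.
Qed.

Lemma roots_rec_uniq n : uniq (roots_rec n).
Proof.
elim: n => //= n IH;
  rewrite cat_uniq !map_inj_uniq ?root_tails_uniq ?IH ?andbT //;
  try exact: cons_row_inj.
apply/hasPn => _ /mapP[v _ ->]; apply/mapP => -[w _ /eqP].
by rewrite eq_cons_row.
Qed.

Definition interval_row n (i j : nat) : 'rV[int]_n := \row_k (i <= k <= j)%N%:R.
Definition hook_row n (i j : nat) : 'rV[int]_n :=
  \row_k ((i <= k)%N%:R + (j <= k)%N%:R).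

Lemma sum_simple_rootE r (P : pred 'I_r) (f : 'I_r -> nat) k :
  (\sum_(l < r | P l) simple_root l *+ f l) 0 k = if P k then (f k)%:R else 0.
Proof.
rewrite summxE; case: ifPn => [Pk|nPk].
  rewrite (bigD1 k) //= mulmxnE mxE !eqxx big1 ?addr0 // => l /andP[_ lk].
  by rewrite mulmxnE mxE eq_sym (negPf lk) andbF mul0rn.
rewrite big1 // => l h; rewrite mulmxnE mxE eqxx /=.
case: (k =P l) => [e|_]; last by rewrite mul0rn.
by move: h; rewrite -e (negPf nPk).
Qed.

Lemma nonhookedE r (i j : 'I_r) : nonhooked i j = interval_row r i j.
Proof.
apply/rowP => k; rewrite mxE /nonhooked.
under eq_bigr do rewrite -[simple_root _]mulr1n.
by rewrite (sum_simple_rootE _ (fun=> 1%N)); case: ifP.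
Qed.

Lemma hookedE r (i j : 'I_r) : (i < j)%N -> hooked i j = hook_row r i j.
Proof.
move=> ij; apply/rowP => k; rewrite !mxE.
under eq_bigr do rewrite -[simple_root _]mulr1n.
rewrite !(sum_simple_rootE _ (fun=> _)).
by case: ifP; case: ifP => *; case: leqP; case: leqP => * //; lia.
Qed.

Lemma highest_rootE n : highest_root n.+1 = cons_row 1 (const_mx 2).
Proof.
apply/rowP => k; rewrite /highest_root sum_simple_rootE /=.
by case: (unliftP ord0 k) => [k' ->|->];
  rewrite ?cons_row_lift ?cons_row_ord0 ?mxE.
Qed.

Lemma posrootsP r v :
  reflect (exists i j, [/\ (i <= j)%N, (j < r)%N & v = interval_row r i j] \/
                       [/\ (i < j)%N, (j < r)%N & v = hook_row r i j])
          (v \in posroots r).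
Proof.
rewrite mem_cat; apply: (iffP orP) => [|[i [j h]]].
  case=> /mapP[[i j]]; rewrite mem_filter /= => /andP[ij _] ->;
    exists i, j; [left | right]; split=> //; first exact: nonhookedE.
  exact: hookedE.
case: h => -[ij jr ->]; [left | right]; apply/mapP.
  have ir := leq_ltn_trans ij jr.
  exists (Ordinal ir, Ordinal jr); first by rewrite mem_filter /= ij mem_enum.
  by rewrite nonhookedE.
have ir := ltn_trans ij jr.
exists (Ordinal ir, Ordinal jr); first by rewrite mem_filter /= ij mem_enum.
by rewrite hookedE.
Qed.

Lemma cons_row_interval0 n j :
  cons_row 1 (interval_row n 0 j) = interval_row n.+1 0 j.+1.
Proof.
by apply/rowP => k; case: (unliftP ord0 k) => [k' ->|->];
  rewrite ?cons_row_lift ?cons_row_ord0 !mxE.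
Qed.

Lemma cons_row_intervalS n i j :
  cons_row 0 (interval_row n i j) = interval_row n.+1 i.+1 j.+1.
Proof.
by apply/rowP => k; case: (unliftP ord0 k) => [k' ->|->];
  rewrite ?cons_row_lift ?cons_row_ord0 !mxE.
Qed.

Lemma cons_row_hook0 n j : cons_row 1 (hook_row n 0 j) = hook_row n.+1 0 j.+1.
Proof.
by apply/rowP => k; case: (unliftP ord0 k) => [k' ->|->];
  rewrite ?cons_row_lift ?cons_row_ord0 !mxE.
Qed.

Lemma cons_row_hookS n i j :
  cons_row 0 (hook_row n i j) = hook_row n.+1 i.+1 j.+1.
Proof.
by apply/rowP => k; case: (unliftP ord0 k) => [k' ->|->];
  rewrite ?cons_row_lift ?cons_row_ord0 !mxE.
Qed.

Lemma interval_row00 n : interval_row n.+1 0 0 = cons_row 1 0.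
Proof.
by apply/rowP => k; case: (unliftP ord0 k) => [k' ->|->];
  rewrite ?cons_row_lift ?cons_row_ord0 !mxE.
Qed.

Lemma hook_row00 n : hook_row n 0 0 = const_mx 2.
Proof. by apply/rowP => k; rewrite !mxE. Qed.

(** After its first coordinate a root ends, doubles at once, or continues with coefficient 1: these
    are the entries [0] and [const_mx 2] and the recursive part of [root_tails]. *)
Lemma root_tailsP n v :
  reflect ((exists2 j, (j <= n)%N & cons_row 1 v = interval_row n.+1 0 j) \/
           (exists2 j, (j < n)%N & cons_row 1 v = hook_row n.+1 0 j.+1))
          (v \in root_tails n).
Proof.
elim: n v => [|n IH] v.
  rewrite inE; apply: (iffP eqP) => [->|]; last by move=> _; apply/rowP=> -[].
  by left; exists 0%N; rewrite ?interval_row00.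
rewrite /= 2!inE; apply: (iffP or3P) => [[/eqP->|/eqP->|/mapP[w /IH hw ->]]|].
- by left; exists 0%N; rewrite ?interval_row00.
- by right; exists 0%N; rewrite // -cons_row_hook0 hook_row00.
- case: hw => -[j hj ->]; [left | right]; exists j.+1 => //.
    by rewrite cons_row_interval0.
  by rewrite cons_row_hook0.
have in_map j : (v = interval_row n.+1 0 j /\ (j <= n)%N) \/
                (v = hook_row n.+1 0 j.+1 /\ (j < n)%N) ->
    v \in map (cons_row 1) (root_tails n).
  move=> h; have v0 : v 0 ord0 = 1 by case: h => -[-> _]; rewrite !mxE.
  have := cons_row_eta v; rewrite v0; set w := \row_k _ => vw.
  rewrite vw map_f //; apply/IH; rewrite -vw.
  by case: h => -[-> hj]; [left | right]; exists j.
case=> -[[|j] hj].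
- by rewrite interval_row00 => /cons_row_inj ->; constructor 1.
- rewrite -cons_row_interval0 => /cons_row_inj e; constructor 3.
  by apply: (in_map j); left.
- rewrite -cons_row_hook0 hook_row00 => /cons_row_inj ->; constructor 2.
  by rewrite eqxx.
- rewrite -cons_row_hook0 => /cons_row_inj e; constructor 3.
  by apply: (in_map j); right.
Qed.

(** Starting index 0 gives the first block; otherwise lowering both indices by one gives a root of
    rank one less. *)
Lemma mem_roots_rec n : posroots n =i roots_rec n.
Proof.
elim: n => [|n IH] v.
  by rewrite [RHS]in_nil; apply/posrootsP => -[i [j [] []]].
rewrite [RHS]mem_cat; apply/posrootsP/orP => [[i [j h]]|].
  case: i h => [|i] h.
    left; have v0 : v 0 ord0 = 1.
      by case: h => -[ij _ ->]; rewrite !mxE //=; case: j ij.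
    have := cons_row_eta v; rewrite v0; set w := \row_k _ => vw.
    rewrite vw map_f //; apply/root_tailsP; rewrite -vw.
    case: h => -[ij jn ->]; first by left; exists j.
    by right; case: j ij jn => // j _ jn; exists j.
  right; case: j h => [|j] [] [] // ij jn ->.
    rewrite -cons_row_intervalS map_f // -IH.
    by apply/posrootsP; exists i, j; left.
  rewrite -cons_row_hookS map_f // -IH.
  by apply/posrootsP; exists i, j; right.
case=> /mapP[w hw ->].
  move/root_tailsP: hw => [] [j hj ->]; exists 0%N; [exists j | exists j.+1].
    by left.
  by right.
move: hw; rewrite -IH => /posrootsP[i [j [] [ij jn ->]]]; exists i.+1, j.+1.
  by left; rewrite cons_row_intervalS.
by right; rewrite cons_row_hookS.
Qed.

Lemma card_root_partitions n k :
  #|root_partitions n k|%:R = nb_msets (roots_rec n) k (highest_root n).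
Proof. exact: card_msets_seq_sub (roots_rec_uniq n) (@mem_roots_rec n). Qed.

(** * Recurrences for the strands *)

(* Partitions of (2, ..., 2) by roots of B_n together with two strands entering
   from the left, ordered here and unordered in twin_strands. *)
Definition two_strands n k : int :=
  \sum_(s <- root_tails n) \sum_(t <- root_tails n)
     nb_msets (roots_rec n) k (const_mx 2 - (s + t)).

Definition twin_strands n k : int :=
  sum_pairs (fun w => nb_msets (roots_rec n) k (const_mx 2 - w)) (root_tails n).

Lemma nb_msets_roots_rec0 n k : nb_msets (roots_rec n) k 0 = (k == 0%N)%:R.
Proof.
elim: n => [|n IH]; first by rewrite /= eqxx andbT.
by rewrite -cons_row0 nb_msets_first0 IH.
Qed.

Lemma nb_msets_roots_rec2 n k :
  nb_msets (roots_rec n.+1) k (const_mx 2) =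
  if k is k'.+2 then twin_strands n k' else 0.
Proof. by rewrite -cons_row_const nb_msets_first2. Qed.

Lemma nb_msets_roots_rec_lt0 n k (u : 'rV[int]_n.+1) :
  u 0 ord0 < 0 -> nb_msets (roots_rec n.+1) k u = 0.
Proof. by apply: nb_msets_lt0 => b; apply: first_ge0. Qed.

(** The entering strand continues with coefficient 1, so exactly one new root, costing one part,
    starts here and becomes the other strand. *)
Lemma nb_msets_roots_rec1 n k :
  \sum_(t <- map (cons_row 1) (root_tails n))
    nb_msets (roots_rec n.+1) k (const_mx 2 - t) =
  if k is k'.+1 then two_strands n k' else 0.
Proof.
rewrite big_map; under eq_bigr => t _ do
  rewrite -cons_row_const cons_rowB [2 - 1](_ : _ = 1) // nb_msets_first1.
case: k => [|k]; first by rewrite big1.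
by apply: eq_bigr => s _; apply: eq_bigr => t _; rewrite opprD addrA.
Qed.

(** The unique root through the first coordinate doubles (nothing remains), continues (one new root
    joins it) or ends (two new roots start). *)
Lemma nb_msets_highest_root n k :
  nb_msets (roots_rec n.+2) k (highest_root n.+2) =
  if k is k'.+1 then
    (k' == 0%N)%:R + (if k' is k''.+1 then two_strands n k'' else 0)
    + (if k' is k''.+2 then twin_strands n k'' else 0)
  else 0.
Proof.
rewrite highest_rootE nb_msets_first1; case: k => // k.
rewrite [root_tails _]/= 2!big_cons nb_msets_roots_rec1 subr0 subrr.
by rewrite nb_msets_roots_rec0 nb_msets_roots_rec2; ring.
Qed.

Lemma nb_msets_two_cons_row n k (s t : 'rV[int]_n) :
  nb_msets (roots_rec n.+1) k (const_mx 2 - (cons_row 1 s + cons_row 1 t)) =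
  nb_msets (roots_rec n) k (const_mx 2 - (s + t)).
Proof.
rewrite opprD addrA -cons_row_const !cons_rowB [2 - 1 - 1](_ : _ = 0) //.
by rewrite nb_msets_first0 -addrA -opprD.
Qed.

Lemma nb_msets_roots_rec_gt2 n k (u : 'rV[int]_n.+1) :
  0 < u 0 ord0 ->
    nb_msets (roots_rec n.+1) k (const_mx 2 - (const_mx 2 + u)) = 0.
Proof.
by move=> hu; rewrite opprD addNKr nb_msets_roots_rec_lt0 // mxE oppr_lt0.
Qed.

Lemma sum_roots_rec_gt2 n k (T : seq 'rV[int]_n) :
  \sum_(t <- map (cons_row 1) T)
    nb_msets (roots_rec n.+1) k (const_mx 2 - (const_mx 2 + t)) = 0.
Proof.
by rewrite big_map big1 // => t _;
  rewrite nb_msets_roots_rec_gt2 ?cons_row_ord0.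
Qed.

(** Each strand ends, doubles or continues. Both continue: distinct strands again. One ends, one
    continues: one new root, in two orders. Both end: two new roots, forming twin strands. One ends,
    one doubles: nothing remains, in two orders. All other cases exceed 2. *)
Lemma two_strandsS n k :
  two_strands n.+1 k =
  two_strands n k + (if k is k'.+1 then two_strands n k' else 0) *+ 2
  + (if k is k'.+2 then twin_strands n k' else 0) + (k == 0%N)%:R *+ 2.
Proof.
rewrite {1}/two_strands [root_tails n.+1]/= 2!big_cons; set M := map _ _.
have hM : \sum_(s <- M) \sum_(t <- [:: 0, const_mx 2 & M])
    nb_msets (roots_rec n.+1) k (const_mx 2 - (s + t)) =
  (if k is k'.+1 then two_strands n k' else 0) + two_strands n k.
  rewrite -nb_msets_roots_rec1 /two_strands -/M !big_map -big_split.
  apply: eq_bigr => s _; rewrite 2!big_cons addr0; congr (_ + _).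
  rewrite [cons_row 1 s + _]addrC
    nb_msets_roots_rec_gt2 ?cons_row_ord0 // add0r.
  by rewrite big_map; apply: eq_bigr => t _; rewrite nb_msets_two_cons_row.
rewrite hM !big_cons !addr0 add0r subr0 subrr nb_msets_roots_rec0.
rewrite nb_msets_roots_rec2 nb_msets_roots_rec_gt2 ?mxE //.
under eq_bigr do rewrite add0r.
rewrite nb_msets_roots_rec1 sum_roots_rec_gt2.
by ring.
Qed.

Lemma sum_pairs_cons_row n k (T : seq 'rV[int]_n) :
  sum_pairs (fun w => nb_msets (roots_rec n.+1) k (const_mx 2 - w))
    (map (cons_row 1) T) =
  sum_pairs (fun w => nb_msets (roots_rec n) k (const_mx 2 - w)) T.
Proof.
elim: T => //= s T ->; congr (_ + _); rewrite -map_cons big_map.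
by apply: eq_bigr => t _; rewrite nb_msets_two_cons_row.
Qed.

(** The same cases for unordered pairs: mixed cases now count once. *)
Lemma twin_strandsS n k :
  twin_strands n.+1 k =
  twin_strands n k + (if k is k'.+1 then two_strands n k' else 0)
  + (if k is k'.+2 then twin_strands n k' else 0) + (k == 0%N)%:R.
Proof.
rewrite {1}/twin_strands [root_tails n.+1]/=; set M := map _ _.
rewrite /sum_pairs -/sum_pairs sum_pairs_cons_row.
rewrite !big_cons addr0 add0r subr0 subrr nb_msets_roots_rec0.
rewrite nb_msets_roots_rec2 nb_msets_roots_rec_gt2 ?mxE //.
under eq_bigr do rewrite add0r.
rewrite nb_msets_roots_rec1 sum_roots_rec_gt2.
by rewrite /twin_strands; ring.
Qed.

(** * Generating polynomials and the recurrence in the rank *)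

(** At rank 0 the only tail is the empty row and only the empty partition remains, whence the
    initial pair [(1, 1)]. *)
Fixpoint strand_polys (n : nat) : {poly int} * {poly int} :=
  if n is m.+1 then
    let: (d, s) := strand_polys m in
    (d + 'X * d *+ 2 + 'X * ('X * s) + 1 *+ 2, s + 'X * d + 'X * ('X * s) + 1)
  else (1, 1).

Lemma strand_polysP n k :
  two_strands n k = (strand_polys n).1`_k /\
  twin_strands n k = (strand_polys n).2`_k.
Proof.
elim: n k => [|n IH] k.
  have e0 (u : 'rV[int]_0) : u == 0 by apply/eqP/rowP => -[].
  rewrite /two_strands /twin_strands /= !big_seq1 e0 coef1 andbT.
  by rewrite addr0.
rewrite two_strandsS twin_strandsS /=; case: (strand_polys n) IH => d s /= IH.
have IHd l := proj1 (IH l); have IHs l := proj2 (IH l).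
rewrite !(coefD, coefMn, coef1, coefXM) !IHd !IHs.
by case: k => [|[|k]] /=; rewrite ?IHd ?IHs.
Qed.

Lemma kostantB1 : kostantB 1 = 'X.
Proof.
apply/polyP => k; rewrite coef_kostantB // card_root_partitions highest_rootE.
rewrite nb_msets_first1 coefX; case: k => // k.
have e0 (u : 'rV[int]_0) : u == 0 by apply/eqP/rowP => -[].
by rewrite /= big_seq1 e0 andbT.
Qed.

Lemma kostantBSS n :
  kostantB n.+2 =
  'X * (1 + 'X * (strand_polys n).1 + 'X * ('X * (strand_polys n).2)).
Proof.
apply/polyP => k; rewrite coef_kostantB // card_root_partitions.
rewrite nb_msets_highest_root !(coefD, coef1, coefXM).
have hd l := proj1 (strand_polysP n l); have hs l := proj2 (strand_polysP n l).
by case: k => [|[|[|k]]] //=; rewrite ?hd ?hs.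
Qed.

(** All three terms are affine in the strand polynomials of rank [n], so this is a polynomial
    identity. Rank 1 stays outside, as [kostantBSS] starts at rank 2. *)
Lemma kostantB_rec n :
  kostantB n.+4 =
  (2 + 2 * 'X + 'X ^+ 2) * kostantB n.+3
  - (1 + 2 * 'X + 'X ^+ 2 + 'X ^+ 3) * kostantB n.+2.
Proof.
rewrite !kostantBSS /=; case: (strand_polys n) => d s /=; ring.
Qed.

(** * Algebra of formal power series *)

Section FpsDivision.
Variable R : comUnitRingType.
Implicit Types a b c : fps R.

(** Coefficients up to [N] of a product involve only coefficients up to [N], so ring laws transfer
    from [{poly R}]. *)
Definition fps_trunc (N : nat) a : {poly R} := \poly_(i < N.+1) a i.

Lemma coef_fps_trunc N a i : (i <= N)%N -> (fps_trunc N a)`_i = a i.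
Proof. by move=> iN; rewrite coef_poly ltnS iN. Qed.

Lemma coef_fps_truncM N a b i : (i <= N)%N ->
  (fps_trunc N a * fps_trunc N b)`_i = fps_mul a b i.
Proof.
move=> iN; rewrite coefM; apply: eq_bigr => j _.
by rewrite !coef_fps_trunc //; have := ltn_ord j; lia.
Qed.

Lemma fps_mulC a b : fps_mul a b =1 fps_mul b a.
Proof.
by move=> n; rewrite -(coef_fps_truncM _ _ (leqnn n)) mulrC coef_fps_truncM.
Qed.

Lemma fps_mulA a b c : fps_mul a (fps_mul b c) =1 fps_mul (fps_mul a b) c.
Proof.
move=> n.
transitivity ((fps_trunc n a * (fps_trunc n b * fps_trunc n c))`_n).
  rewrite coefM; apply: eq_bigr => i _.
  by rewrite coef_fps_truncM ?leq_subr // coef_fps_trunc ?leq_ord.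
rewrite mulrA coefM; apply: eq_bigr => i _.
by rewrite coef_fps_truncM ?leq_ord // coef_fps_trunc ?leq_subr.
Qed.

Lemma eq_fps_mul a a' b b' : a =1 a' -> b =1 b' -> fps_mul a b =1 fps_mul a' b'.
Proof. by move=> ea eb n; apply: eq_bigr => i _; rewrite ea eb. Qed.

Lemma fps_mul1 a : fps_mul (fps_of_poly 1) a =1 a.
Proof.
move=> n;
  rewrite /fps_mul big_ord_recl /fps_of_poly coef1 mul1r subn0 big1 ?addr0 //.
by move=> i _; rewrite coef1 mul0r.
Qed.

(** Multiplying by the inverse of [b] shows that a quotient can be checked with its denominator
    cleared. *)
Lemma fps_div_eq a b c :
  b 0%N \is a GRing.unit -> fps_mul b c =1 a -> c =1 fps_div a b.
Proof.
move=> ub bc n; rewrite /fps_div fps_mulC -(eq_fps_mul (frefl _) bc) fps_mulA.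
rewrite -[LHS]fps_mul1; apply: eq_fps_mul => // i.
by rewrite fps_mulC fps_mulV.
Qed.

End FpsDivision.

(** * The rational form of the generating function *)

Theorem theorem3p8 :
  let q : {poly {poly int}} := ('X)%:P in
  let x : {poly {poly int}} := 'X in
  kostantB_gf =1
  fps_div
    (fps_of_poly (q * x + (- q - q ^+ 2) * x ^+ 2 + q ^+ 2 * x ^+ 3))
    (fps_of_poly (1 - (2 + 2 * q + q ^+ 2) * x
                  + (1 + 2 * q + q ^+ 2 + q ^+ 3) * x ^+ 2)).
Proof.
move=> q x.
(* Trace and determinant of the transfer matrix. *)
pose t : {poly int} := 2 + 2 * 'X + 'X ^+ 2.
pose d : {poly int} := 1 + 2 * 'X + 'X ^+ 2 + 'X ^+ 3.
set num := q * x + _ + _; set den := 1 - _ + _.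
have numE : num = 'X%:P * 'X + (- 'X - 'X ^+ 2)%:P * 'X^2 + ('X ^+ 2)%:P * 'X^3.
  by rewrite /num /q /x; ring.
have denE : den = 1 - t%:P * 'X + d%:P * 'X^2.
  by rewrite /den /q /x /t /d; ring.
have den_coef n : fps_of_poly den n =
    (n == 0%N)%:R - t * (n == 1%N)%:R + d * (n == 2%N)%:R.
  by rewrite /fps_of_poly denE !(coefD, coefN, coefCM, coefX, coefXn, coef1).
have num_coef n : fps_of_poly num n =
    'X * (n == 1%N)%:R + (- 'X - 'X ^+ 2) * (n == 2%N)%:R +
      'X ^+ 2 * (n == 3%N)%:R.
  by rewrite /fps_of_poly numE !(coefD, coefCM, coefX, coefXn).
apply: fps_div_eq => [|n];
  first by rewrite den_coef /= !mulr0 subr0 addr0 unitr1.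
rewrite num_coef /fps_mul; under eq_bigr do rewrite den_coef.
case: n => [|[|[|n]]].
- by rewrite big_ord1 /kostantB_gf /=; ring.
- by rewrite 2!big_ord_recl big_ord0 /kostantB_gf /= kostantB1; ring.
- rewrite 3!big_ord_recl big_ord0 /kostantB_gf /= kostantB1 kostantBSS /= /t.
  by ring.
(* From degree 3 on, all three nonzero coefficients of [den] contribute. *)
rewrite 3!big_ord_recl /= big1 => [|i _];
  last by rewrite /= !mulr0 subr0 addr0 mul0r.
rewrite /bump /= /kostantB_gf.
(* Degree 3 involves [kostantB 1], outside the recurrence, and leaves the numerator term ['X ^+ 2];
   higher degrees vanish by [kostantB_rec]. *)
case: n => [|n] /=.
  by rewrite subn0 kostantB1 !kostantBSS /= /t /d; ring.
by rewrite !subSS subn0 /= kostantB_rec -/t -/d; ring.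
Qed.
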